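(* Let $(\mathscr{B},|\cdot|)$ be an ultrametric Banach algebra with a continuous derivation $d:\mathscr{B}\to\mathscr{B}$ of operator norm $|d|$, and let $(M,\nabla)$ be a differential module over $(\mathscr{B},d)$ of rank $n$ with basis $\mathbf{e}=\{e_0,\ldots,e_{n-1}\}$. Assume that $(n-1)!$ is invertible in $\mathscr{B}$ and that there is an element $t\in\mathscr{B}$ with $d(t)=1$. Let $G_1\in M_n(\mathscr{B})$ be the matrix of $\nabla$ in the basis $\mathbf{e}$, and let $|G_1|^{(|t|^{-1})}$ be its $\rho$-sup-norm for $\rho=|t|^{-1}$. Assume that $$|G_1|^{(|t|^{-1})}\;<\;\frac{|(n-1)!|^2\,|d|}{(|d||t|)^{2n-2}}.$$ Then $(M,\nabla)$ is cyclic, and the Katz vector $c_0(\mathbf{e},t)$ is a cyclic vector for $M$.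
   Context: An ultrametric norm on a commutative unital ring $\mathscr{B}$ is a map $|\cdot|:\mathscr{B}\to\mathbb{R}_{\ge 0}$ with $|0|=0$, $|1|=1$, $|a+b|\le\max(|a|,|b|)$, $|ab|\le|a||b|$ for all $a,b\in\mathscr{B}$, and moreover $|na|=|n||a|$ for all $n\in\mathbb{Z}$, $a\in\mathscr{B}$ (where $|n|:=|n\cdot 1|$). An ultrametric Banach algebra is such a ring that is complete and separated ($|a|=0$ implies $a=0$) for $|\cdot|$. The norm is not assumed multiplicative. A derivation $d$ of $\mathscr{B}$ is a $\mathbb{Z}$-linear map with $d(ab)=ad(b)+d(a)b$. Its operator norm is $|d|:=\sup_{b\neq0}|d(b)|/|b|$, which is a finite real number. A differential module $(M,\nabla)$ of rank $n$ over $(\mathscr{B},d)$ is a free $\mathscr{B}$-module $M$ of finite rank $n$ with a $\mathbb{Z}$-linear map $\nabla:M\to M$ such that $\nabla(bm)=d(b)m+b\nabla(m)$ for $b\in\mathscr{B}$, $m\in M$. A cyclic vector is an element $m\in M$ such that $\{m,\nabla(m),\ldots,\nabla^{n-1}(m)\}$ is a basis of $M$ over $\mathscr{B}$; $M$ is cyclic if it has a cyclic vector. The matrix $G_1=(g_{i,j})_{i,j=0,\ldots,n-1}$ is defined by $\nabla(e_i)=\sum_{j=0}^{n-1}g_{i,j}e_j$. For $\rho>0$ the $\rho$-sup-norm of a matrix is $|(a_{i,j})|^{(\rho)}:=\sup_{i,j}|a_{i,j}|\rho^{j-i}$; thus $|(a_{i,j})|^{(|t|^{-1})}=\sup_{i,j}|a_{i,j}||t|^{i-j}$.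 The Katz vector is $$c_0(\mathbf{e},t)=\sum_{j=0}^{n-1}\frac{t^j}{j!}\sum_{k=0}^{j}(-1)^k\binom{j}{k}\nabla^k(e_{j-k}).$$ *)

(* Defs.v *)
From HB Require Import structures.
From mathcomp Require Import all_boot all_order all_algebra.
From mathcomp Require Import all_classical all_reals.

Set Implicit Arguments.
Unset Strict Implicit.
Unset Printing Implicit Defensive.

Import Order.TTheory GRing.Theory Num.Theory.

Local Open Scope classical_set_scope.
Local Open Scope ring_scope.

Definition cauchy_for (R : realType) (B : zmodType) (nrm : B -> R)
    (u : nat -> B) : Prop :=
  forall eps : R, 0 < eps -> exists N : nat, forall p q : nat,
    (N <= p)%N -> (N <= q)%N -> nrm (u p - u q) < eps.

Definition converges_for (R : realType) (B : zmodType) (nrm : B -> R)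
    (u : nat -> B) (l : B) : Prop :=
  forall eps : R, 0 < eps -> exists N : nat, forall p : nat,
    (N <= p)%N -> nrm (u p - l) < eps.

(* MathComp's [normedZmodType] and the structures built on it cannot be used:
   the axiom [`|x *+ n| = `|x| *+ n] excludes ultrametric norms. *)
HB.mixin Record isUltrametricBanach (R : realType) B & GRing.ComUnitRing B := {
  unorm : B -> R ;
  unorm_ge0 : forall a : B, 0 <= unorm a ;
  unorm0 : unorm 0 = 0 ;
  unorm1 : unorm 1 = 1 ;
  unormD : forall a b : B, unorm (a + b) <= Num.max (unorm a) (unorm b) ;
  unormM : forall a b : B, unorm (a * b) <= unorm a * unorm b ;
  unormMz : forall (n : int) (a : B), unorm (a *~ n) = unorm n%:~R * unorm a ;
  unorm_eq0 : forall a : B, unorm a = 0 -> a = 0 ;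
  unorm_complete : forall u : nat -> B,
    cauchy_for unorm u -> exists l, converges_for unorm u l
}.

#[short(type="ultrametricBanachType")]
HB.structure Definition UltrametricBanach (R : realType) :=
  {B of GRing.ComUnitRing B & isUltrametricBanach R B}.

Definition leibniz (B : comUnitRingType) (d : B -> B) : Prop :=
  forall a b, d (a * b) = a * d b + d a * b.

Section OperatorNorm.
Context {R : realType} {B : ultrametricBanachType R}.

Definition norm_ratios (d : B -> B) : set R :=
  [set unorm (d b) / unorm b | b in [set b : B | b != 0]].

Definition unorm_continuous (f : B -> B) : Prop :=
  forall (a : B) (eps : R), 0 < eps ->
    exists2 delta : R, 0 < delta &
      forall b : B, unorm (b - a) < delta -> unorm (f b - f a) < eps.

(* [sup] is the least upper bound only for a nonempty set with an upper bound,
   whence the need for [finite_opnorm]. *)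
Definition opnorm (d : B -> B) : R := sup (norm_ratios d).

Definition finite_opnorm (d : B -> B) : Prop := has_ubound (norm_ratios d).

Definition rho_norm n (rho : R) (A : 'M[B]_n) : R :=
  \big[Num.max/0]_(i < n) \big[Num.max/0]_(j < n)
    (unorm (A i j) * rho ^ (j%:Z - i%:Z)).

End OperatorNorm.

Section DifferentialModule.
Context {B : comUnitRingType} {M : lmodType B}.

Definition is_basis n (e : 'I_n -> M) : Prop :=
  (forall m : M, exists c : 'I_n -> B, m = \sum_(i < n) c i *: e i) /\
  (forall c : 'I_n -> B,
     \sum_(i < n) c i *: e i = 0 -> forall i, c i = 0).

Definition connection (d : B -> B) (nabla : M -> M) : Prop :=
  forall (b : B) (m : M), nabla (b *: m) = d b *: m + b *: nabla m.

Definition matrix_in_basis n (nabla : M -> M) (e : 'I_n -> M)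
    (G : 'M[B]_n) : Prop :=
  forall i, nabla (e i) = \sum_(j < n) G i j *: e j.

Definition cyclic_vector n (nabla : M -> M) (m : M) : Prop :=
  is_basis (fun i : 'I_n => iter i nabla m).

Definition cyclic n (nabla : M -> M) : Prop :=
  exists m, cyclic_vector n nabla m.

Definition ord_sub n (j : 'I_n) (k : nat) : 'I_n :=
  Ordinal (leq_ltn_trans (leq_subr k j) (ltn_ord j)).

Definition katz_vector n (nabla : M -> M) (e : 'I_n -> M) (t : B) : M :=
  \sum_(j < n) (t ^+ j / (j`!)%:R) *:
    \sum_(k < j.+1)
      ((-1) ^+ k * ('C(j, k))%:R) *: iter k nabla (e (ord_sub j k)).

End DifferentialModule.

Arguments cyclic_vector {B M} n nabla m.
Arguments cyclic {B M} n nabla.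

(* Main.v *)
(* Weight coordinates in the basis e by rho^l with rho = 1/|t|. With the shift
   e_l |-> e_(l+1) treated as commuting with nabla, the Katz vector is
   exp(t (shift - nabla)) e_0 truncated, so nabla^i of it is
   sum_j t^j/j! e_(i+j) up to terms containing nabla at least once. Since
   |G1| <= |d|, each such nabla costs at most |d|, and these terms are bounded by
   (|G1|/|d|) (|d||t|)^(2n-2) / |(n-1)!|. Multiplying the matrix of the
   nabla^i by the unipotent matrix ((-t)^(k-i)/(k-i)!), which costs another
   1/|(n-1)!|, leaves a matrix at distance < 1 from the identity; its determinant
   is 1 + x with |x| < 1, a unit by the geometric series. *)
Require Import Defs.
From HB Require Import structures.
From mathcomp Require Import all_boot all_order all_algebra.
From mathcomp Require Import all_classical all_reals.
From mathcomp Require Import perm ring lra.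

Import Order.TTheory GRing.Theory Num.Theory.

Local Open Scope classical_set_scope.
Local Open Scope ring_scope.

(** * Ultrametric norms, and matrices close to the identity *)

(** Bernoulli's inequality bounds [q ^+ N] by the inverse of [1 + N (1 - q)], and [R] is
    archimedean. *)
Lemma expr_small (R : realType) (q eps : R) :
  0 <= q < 1 -> 0 < eps -> exists N : nat, q ^+ N < eps.
Proof.
move=> /andP[q0 q1] eps0.
have bern N : q ^+ N * (1 + N%:R * (1 - q)) <= 1.
  elim: N => [|N IH]; first by rewrite expr0 mul0r; lra.
  apply: le_trans IH; rewrite exprSr -mulrA ler_wpM2l ?exprn_ge0//.
  have s0 : 0 <= (N%:R + 1) * ((1 - q) * (1 - q)).
    have s1 : 0 <= 1 - q by lra.
    by rewrite mulr_ge0 ?addr_ge0// mulr_ge0.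
  by rewrite -natr1; lra.
have c0 : 0 < (1 - q) * eps by rewrite mulr_gt0 ?subr_gt0.
exists (Num.bound ((1 - q) * eps)^-1).
have /archi_boundP : 0 <= ((1 - q) * eps)^-1 by rewrite invr_ge0 ltW.
set N := Num.bound _.
rewrite -(ltr_pM2r c0) mulVf ?gt_eqF// => H.
have qN : 0 <= q ^+ N by rewrite exprn_ge0.
have P : 0 < N%:R * (1 - q).
  by rewrite -(pmulr_lgt0 _ eps0) -mulrA; lra.
rewrite -(ltr_pM2r P); have := bern N; rewrite mulrDr mulr1 => H2.
lra.
Qed.

Section UltrametricNorm.
Context {R : realType} {B : ultrametricBanachType R}.
Implicit Types a b x : B.

Lemma unorm_natM (k : nat) a : unorm (k%:R * a) = unorm (k%:R : B) * unorm a.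
Proof. by have := unormMz k%:Z a; rewrite -mulrzl. Qed.

Lemma unormN a : unorm (- a) = unorm a.
Proof.
have le b : unorm (- b) <= unorm b.
  have N1 : unorm (-1 : B) = 1.
    have := unormMz (-1) (-1 : B); rewrite mulrN1z opprK unorm1 rmorphN1 => /eqP.
    rewrite eq_sym -expr2 sqrf_eq1 => /orP[/eqP//|/eqP h].
    by have := unorm_ge0 (-1 : B); rewrite h; lra.
  by rewrite -mulN1r (le_trans (unormM _ _))// N1 mul1r.
by apply/eqP; rewrite eq_le le -{1}[a]opprK le.
Qed.

Lemma unormD_le a b (C : R) : unorm a <= C -> unorm b <= C -> unorm (a + b) <= C.
Proof. by move=> ha hb; rewrite (le_trans (unormD a b))// ge_max ha hb. Qed.

Lemma unorm_sum_le (I : Type) (r : seq I) (P : pred I) (F : I -> B) (C : R) :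
  0 <= C -> (forall i, P i -> unorm (F i) <= C) ->
  unorm (\sum_(i <- r | P i) F i) <= C.
Proof.
move=> C0 FC; elim/big_ind: _ => //; first by rewrite unorm0.
by move=> x y; exact: unormD_le.
Qed.

Lemma unormM_le a b (C D : R) :
  unorm a <= C -> unorm b <= D -> unorm (a * b) <= C * D.
Proof.
by move=> ha hb; rewrite (le_trans (unormM a b))// ler_pM ?unorm_ge0.
Qed.

Lemma unorm_nat_le1 (k : nat) : unorm (k%:R : B) <= 1.
Proof.
elim: k => [|k IH]; first by rewrite unorm0.
by rewrite -natr1 unormD_le ?unorm1.
Qed.

Lemma unormX_le a k : unorm (a ^+ k) <= unorm a ^+ k.
Proof.
elim: k => [|k IH]; first by rewrite !expr0 unorm1.
by rewrite !exprS unormM_le.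
Qed.

Lemma unorm_gt0 a : a != 0 -> 0 < unorm a.
Proof.
move=> a0; rewrite lt0r unorm_ge0 andbT.
by apply/negP => /eqP/unorm_eq0/eqP; exact/negP.
Qed.

(* The Neumann series needs completeness only in dimension one: matrices close
   to the identity are treated through their determinant. *)
Lemma unit_1D x : unorm x < 1 -> 1 + x \is a GRing.unit.
Proof.
move=> x1; pose y := - x; pose u N : B := \sum_(k < N) y ^+ k.
have y1 : unorm y < 1 by rewrite unormN.
have small eps : 0 < eps -> exists N, forall p, (N <= p)%N -> unorm (y ^+ p) < eps.
  move=> e0; have [|N HN] := @expr_small _ (unorm y) eps _ e0.
    by rewrite unorm_ge0.
  exists N => p Np; apply: le_lt_trans HN; rewrite (le_trans (unormX_le _ _))//.
  by rewrite ler_wiXn2l ?unorm_ge0 ?ltW.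
have uM N : (1 + x) * u N = 1 - y ^+ N.
  rewrite -[x]opprK -/y; elim: N => [|N IH]; first by rewrite /u big_ord0; ring.
  by rewrite /u big_ord_recr /= mulrDr -/(u N) IH exprS; ring.
have ctr N p : (N <= p)%N -> unorm (u p - u N) <= unorm y ^+ N.
  move=> Np; rewrite /u -!(big_mkord xpredT (fun k => y ^+ k)).
  rewrite (big_cat_nat (leq0n N) Np)//= addrAC subrr add0r.
  rewrite big_nat; apply: unorm_sum_le => [|k /andP[Nk _]].
    by rewrite exprn_ge0 ?unorm_ge0.
  by rewrite (le_trans (unormX_le _ _))// ler_wiXn2l ?unorm_ge0 ?ltW.
have [|l ul] := unorm_complete (u : nat -> B).
  move=> eps e0; have [|N HN] := @expr_small _ (unorm y) eps _ e0.
    by rewrite unorm_ge0.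
  exists N => p q Np Nq; apply: le_lt_trans HN.
  have -> : u p - u q = (u p - u N) - (u q - u N) by ring.
  by apply: unormD_le; rewrite ?[leLHS]unormN ctr.
apply/unitrPr; exists l; apply/eqP; rewrite -subr_eq0; apply/eqP/unorm_eq0.
(* A nonzero defect [(1 + x) * l - 1] would supply its own norm as epsilon, yet for large [p] it is
   a sum of two terms of strictly smaller norm. *)
apply/eqP; rewrite eq_le unorm_ge0 andbT leNgt; apply/negP => e0.
have [N1 H1] := ul _ e0; have [N2 H2] := small _ e0.
have M1 : (N1 <= maxn N1 N2)%N by rewrite leq_maxl.
have M2 : (N2 <= maxn N1 N2)%N by rewrite leq_maxr.
move: {H1 H2}(H1 _ M1) (H2 _ M2); set p := maxn _ _ => H1 H2.
suff : unorm ((1 + x) * l - 1) < unorm ((1 + x) * l - 1) by rewrite ltxx.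
have {1}-> : (1 + x) * l - 1 = - ((1 + x) * (u p - l)) - y ^+ p.
  by rewrite mulrBr uM; ring.
rewrite (le_lt_trans (unormD _ _))// gt_max !unormN H2 andbT.
apply: le_lt_trans H1; rewrite -[leRHS]mul1r unormM_le// unormD_le ?unorm1//.
exact: ltW.
Qed.

(** The factors are replaced one at a time. Since [q <= 1], each [a i] is also bounded by [w i]; the
    bound on the product of the [b i] is carried along the induction. *)
Lemma unorm_prod_sub_le (I : Type) (r : seq I) (a b : I -> B) (w : I -> R) (q : R) :
  0 <= q <= 1 -> (forall i, unorm (a i - b i) <= q * w i) ->
  (forall i, unorm (b i) <= w i) ->
  unorm (\prod_(i <- r) a i - \prod_(i <- r) b i) <= q * \prod_(i <- r) w i.
Proof.
move=> /andP[q0 q1] ab bw.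
suff [] : unorm (\prod_(i <- r) a i - \prod_(i <- r) b i) <= q * \prod_(i <- r) w i
  /\ unorm (\prod_(i <- r) b i) <= \prod_(i <- r) w i by [].
elim/big_rec3: _ => [|i z y x _ [IH1 IH2]].
  by rewrite subrr unorm0 unorm1 mulr1.
have w0 : 0 <= w i by rewrite (le_trans (unorm_ge0 _) (bw i)).
split; last exact: unormM_le.
have -> : a i * x - b i * y = a i * (x - y) + (a i - b i) * y by ring.
apply: unormD_le; last by rewrite mulrA unormM_le.
rewrite mulrCA unormM_le// -[a i](subrK (b i)) unormD_le//.
by rewrite (le_trans (ab i))// ler_piMl.
Qed.

(** In the Leibniz expansion of the determinant, the weights [rho ^+ i / rho ^+ (s i)] multiply to 1
    over a permutation [s], so each term differs from that of the identity by at most [q]. Hence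
    [\det A] is 1 plus an element of norm less than 1. *)
Lemma unitmx_near1 n (rho q : R) (A : 'M[B]_n) :
  0 < rho -> 0 <= q < 1 ->
  (forall i j, unorm ((A - 1%:M) i j) * rho ^+ j <= q * rho ^+ i) ->
  A \in unitmx.
Proof.
move=> r0 /andP[q0 q1] HA; have rX k : 0 < rho ^+ k by rewrite exprn_gt0.
rewrite unitmxE -[\det A](subrK 1) addrC; apply: unit_1D.
apply: (le_lt_trans _ q1); rewrite -[X in unorm (_ - X)](det1 B n) /determinant -sumrB.
apply: unorm_sum_le => // s _; rewrite -mulrBr -signr_odd.
rewrite mulr_sign; set D := _ - _; suff h : unorm D <= q by case: ifP; rewrite ?unormN.
have -> : q = q * \prod_(i < n) (rho ^+ i / rho ^+ (s i)).
  rewrite prodf_div [X in X / _](reindex_perm s) /= mulfV ?mulr1//.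
  by apply/prodf_neq0 => i _; rewrite gt_eqF.
apply: unorm_prod_sub_le => [|i|i]; first by rewrite q0 ltW.
  by rewrite mulrA ler_pdivlMr//; have := HA i (s i); rewrite !mxE.
rewrite mxE; case: eqP => [<-|_]; first by rewrite unorm1 mulfV// gt_eqF.
by rewrite unorm0 divr_ge0 ?ltW.
Qed.

End UltrametricNorm.

(** * Divided powers and the unipotent matrix they form *)

Section DividedPowers.
Context {B : comUnitRingType}.
Implicit Types (t : B) (j c m : nat).

Definition divpow t j : B := t ^+ j / (j`!)%:R.

Lemma divpow0 t : divpow t 0 = 1.
Proof. by rewrite /divpow expr0 fact0 divr1. Qed.

Lemma fact_unit_le j m :
  (j <= m)%N -> (m`!)%:R \is a @GRing.unit B -> (j`!)%:R \is a @GRing.unit B.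
Proof. by move=> jm; rewrite (fact_split jm) natrM unitrM => /andP[]. Qed.

(** The coefficient of [X^c] in [exp(-tX) exp(tX) = 1], read off from the binomial expansion of
    [(t - t) ^+ c]. *)
Lemma divpow_convolution t c :
  (c`!)%:R \is a @GRing.unit B ->
  \sum_(a < c.+1) divpow (- t) a * divpow t (c - a) = (c == 0%N)%:R.
Proof.
move=> cU; transitivity ((t - t) ^+ c / (c`!)%:R); last first.
  by rewrite subrr expr0n; case: c cU => [|c] _; rewrite ?fact0 ?divr1 ?mul0r.
rewrite exprDn mulr_suml; apply: eq_bigr => a _.
have ac : (a <= c)%N by rewrite -ltnS.
apply: (mulIr cU); rewrite mulrVK// -(bin_fact ac) !natrM /divpow.
have aU := fact_unit_le _ _ ac cU; have bU := fact_unit_le _ _ (leq_subr a c) cU.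
move: (a`!%:R) aU ((c - a)`!%:R) bU => u uU w wU.
transitivity (t ^+ (c - a) * (- t) ^+ a * 'C(c, a)%:R * (u^-1 * u) * (w^-1 * w)).
  by ring.
by rewrite (mulVr uU) (mulVr wU) !mulr1 mulr_natr.
Qed.

(** This is [exp(tN)], where [N] is the nilpotent matrix with ones just above the diagonal. *)
Definition divpow_mx n t : 'M[B]_n :=
  \matrix_(i, j) if (i <= j)%N then divpow t (j - i) else 0.

Lemma divpow_mxN n t :
  ((n.-1)`!)%:R \is a @GRing.unit B -> divpow_mx n (- t) *m divpow_mx n t = 1%:M.
Proof.
move=> nU; apply/matrixP => i l; rewrite !mxE.
under eq_bigr do rewrite !mxE.
have [il|li] := leqP i l; last first.
  rewrite big1 => [|k _]; first by case: eqP li => [->|]; rewrite ?ltnn.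
  have [ik|] := leqP i k; last by rewrite mul0r.
  by rewrite leqNgt (leq_trans li ik) mulr0.
(* Only the [k] with [i <= k <= l] contribute; shifting by [i] leaves the convolution of order
   [l - i]. *)
pose F k := (if (i <= k)%N then divpow (- t) (k - i) else 0) *
            (if (k <= l)%N then divpow t (l - k) else 0).
rewrite -(big_mkord xpredT F) (big_cat_nat (leq0n i))/=; last exact: ltnW.
rewrite [X in X + _]big_nat big1 ?add0r => [|k /andP[_ ki]]; last first.
  by rewrite /F leqNgt ki mul0r.
rewrite (big_cat_nat (leq_trans il (leqnSn l)))//=.
rewrite [X in _ + X]big_nat [X in _ + X]big1 ?addr0 => [|k /andP[lk _]]; last first.
  by rewrite /F [(k <= l)%N]leqNgt lk mulr0.
rewrite -{1}[val i]add0n big_addn subSn// big_mkord.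
have U : ((l - i)`!)%:R \is a @GRing.unit B.
  apply: fact_unit_le nU; rewrite (leq_trans (leq_subr _ _))//.
  by rewrite -ltnS prednK// (leq_trans _ (ltn_ord i)).
transitivity (((l - i)%N == 0%N)%:R : B).
  rewrite -(divpow_convolution t _ U); apply: eq_bigr => a _.
  have al : (a <= l - i)%N by rewrite -ltnS.
  by rewrite /F leq_addl addnK [(a + i)%N]addnC -leq_subRL// al subnDA.
by congr (_%:R); rewrite subn_eq0 -val_eqE eqn_leq il.
Qed.

End DividedPowers.

(** * Change of basis by an invertible matrix *)

Section Basis.
Context {B : comUnitRingType} {M : lmodType B}.

Lemma is_basis_unitmx n (e v : 'I_n -> M) (V : 'M[B]_n) :
  is_basis e -> V \in unitmx ->
  (forall i, v i = \sum_(j < n) V i j *: e j) -> is_basis v.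
Proof.
move=> [e_gen e_free] VU vE.
have comb (c : 'I_n -> B) :
    \sum_i c i *: v i = \sum_j ((\row_i c i) *m V) 0 j *: e j.
  under eq_bigr do rewrite vE scaler_sumr.
  rewrite exchange_big; apply: eq_bigr => j _ /=.
  by rewrite mxE scaler_suml; apply: eq_bigr => i _; rewrite mxE scalerA.
split=> [m|c].
  have [c ->] := e_gen m.
  exists (fun i => ((\row_i c i) *m invmx V) 0 i); rewrite comb.
  have -> : \row_i ((\row_i c i) *m invmx V) 0 i = (\row_i c i) *m invmx V.
    by apply/rowP => i; rewrite [LHS]mxE.
  by rewrite mulmxKV//; apply: eq_bigr => i _; rewrite mxE.
rewrite comb => /e_free c0 i.
have /(congr1 (mulmx^~ (invmx V))) : (\row_i c i) *m V = 0.
  by apply/rowP => j; rewrite c0 mxE.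
by rewrite mulmxK// mul0mx => /rowP/(_ i); rewrite !mxE.
Qed.

End Basis.

(** * Weighted sup bounds on coordinates, and perturbation of a basis *)

Section WeightedBound.
Context {R : realType} {B : ultrametricBanachType R} {M : lmodType B}.
Context {n : nat} (e : 'I_n -> M) (rho : R).
Implicit Types (m : M) (C : R).

(** Plays the part of a weighted sup norm on [M], as a bound on some coordinate vector of [m], so
    that no coordinate functions have to be chosen. *)
Definition wbound C m : Prop :=
  exists2 c : 'I_n -> B, m = \sum_(l < n) c l *: e l &
    forall l, unorm (c l) * rho ^+ l <= C.

Lemma wbound0 C : 0 <= C -> wbound C 0.
Proof.
move=> C0; exists (fun=> 0) => [|l]; last by rewrite unorm0 mul0r.
by rewrite big1// => l _; rewrite scale0r.
Qed.

Hypothesis rho_gt0 : 0 < rho.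

Lemma wbound_le C D m : C <= D -> wbound C m -> wbound D m.
Proof. by move=> CD [c -> cC]; exists c => // l; exact: le_trans CD. Qed.

Lemma wboundD C m1 m2 : wbound C m1 -> wbound C m2 -> wbound C (m1 + m2).
Proof.
move=> [a -> aC] [b -> bC]; exists (fun l => a l + b l) => [|l].
  by rewrite -big_split; apply: eq_bigr => l _; rewrite scalerDl.
rewrite -ler_pdivlMr ?exprn_gt0//.
by apply: unormD_le; rewrite ler_pdivlMr ?exprn_gt0.
Qed.

Lemma wboundZ C D b m : unorm b <= D -> wbound C m -> wbound (D * C) (b *: m).
Proof.
move=> bD [c -> cC]; exists (fun l => b * c l) => [|l].
  by rewrite scaler_sumr; apply: eq_bigr => l _; rewrite scalerA.
have rX : 0 < rho ^+ l by rewrite exprn_gt0.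
apply: (@le_trans _ _ (unorm b * (unorm (c l) * rho ^+ l))).
  by rewrite mulrA ler_wpM2r ?unormM// ltW.
by rewrite ler_pM ?unorm_ge0// mulr_ge0 ?unorm_ge0 ?ltW.
Qed.

Lemma wboundN C m : wbound C m -> wbound C (- m).
Proof.
by move=> /(wboundZ _ _ (-1) _ (lexx _)); rewrite scaleN1r unormN unorm1 mul1r.
Qed.

Lemma wboundB C m1 m2 : wbound C m1 -> wbound C m2 -> wbound C (m1 - m2).
Proof. by move=> h1 h2; apply: wboundD => //; exact: wboundN. Qed.

Lemma wbound_sum (I : Type) (r : seq I) (P : pred I) (F : I -> M) C :
  0 <= C -> (forall i, P i -> wbound C (F i)) ->
  wbound C (\sum_(i <- r | P i) F i).
Proof.
by move=> C0 FC; elim/big_ind: _ => //; [exact: wbound0 | exact: wboundD].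
Qed.

(** The matrix of [v] is [U + P] with [U = divpow_mx n t] and [P] the error. Multiplied on the left
    by [divpow_mx n (- t)], the inverse of [U], it becomes 1 plus a matrix of weighted norm at most
    [E * C]. *)
Lemma is_basis_near_divpow (E C : R) (t : B) (v : 'I_n -> M) :
  is_basis e -> ((n.-1)`!)%:R \is a @GRing.unit B ->
  (forall k, (k < n)%N -> unorm (divpow (- t) k) * rho ^+ k <= E) ->
  0 <= E * C < 1 ->
  (forall i : 'I_n, wbound (C * rho ^+ i) (v i - \sum_(l < n) divpow_mx n t i l *: e l)) ->
  is_basis v.
Proof.
move=> e_basis nU tE EC1 vC.
have {vC}/fin_all_exists[c cP] : forall i : 'I_n, exists c : 'I_n -> B,
    v i - \sum_(l < n) divpow_mx n t i l *: e l = \sum_(l < n) c l *: e l /\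
    forall l, unorm (c l) * rho ^+ l <= C * rho ^+ i.
  by move=> i; have [c] := vC i; exists c.
pose P : 'M[B]_n := \matrix_(i, l) c i l.
apply: (is_basis_unitmx _ e v (divpow_mx n t + P)) => [//||i]; last first.
  have [/eqP] := cP i; rewrite subr_eq => /eqP -> _.
  by rewrite addrC -big_split; apply: eq_bigr => l _; rewrite !mxE scalerDl.
have : divpow_mx n (- t) *m (divpow_mx n t + P) \in unitmx.
  rewrite mulmxDr divpow_mxN//; apply: (unitmx_near1 _ rho (E * C)) => // i l.
  rewrite addrAC subrr add0r mxE -ler_pdivlMr ?exprn_gt0//.
  have E0 : 0 <= E.
    apply: le_trans (tE 0%N (leq_ltn_trans (leq0n i) (ltn_ord i))).
    by rewrite mulr_ge0 ?unorm_ge0.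
  have r0 := ltW rho_gt0.
  have w0 : 0 <= E * C * rho ^+ i.
    by case/andP: EC1 => ? _; apply: mulr_ge0; rewrite ?exprn_ge0.
  apply: unorm_sum_le => [|k _]; first by rewrite divr_ge0 ?exprn_ge0.
  rewrite !mxE ler_pdivlMr ?exprn_gt0//.
  have [ik|ki] := leqP i k; last by rewrite mul0r unorm0 mul0r.
  apply: (@le_trans _ _ (unorm (divpow (- t) (k - i)) * (unorm (c k l) * rho ^+ l))).
    by rewrite mulrA ler_wpM2r ?exprn_ge0 ?unormM.
  have [_ /(_ l) ckl] := cP k.
  apply: (le_trans (ler_wpM2l (unorm_ge0 _) ckl)).
  (* Of the weight [rho ^+ k] of row [k], the factor [rho ^+ (k - i)] goes to the divided power,
     bounded by [E], and [rho ^+ i] remains as the weight of row [i]. *)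
  rewrite -{2}(subnK ik) exprD mulrCA !mulrA ler_wpM2r ?exprn_ge0//.
  have C0 : 0 <= C.
    rewrite -(pmulr_lge0 _ (exprn_gt0 k rho_gt0)); apply: le_trans ckl.
    by rewrite mulr_ge0 ?unorm_ge0 ?exprn_ge0.
  rewrite -mulrA mulrC ler_wpM2r//; apply: tE.
  by rewrite (leq_ltn_trans (leq_subr _ _)).
by rewrite unitmx_mul => /andP[].
Qed.

End WeightedBound.

(** * Algebra of the Katz vector and its derivatives *)

Section KatzVector.
Context {B : comUnitRingType} {M : lmodType B}.
Context (d : {additive B -> B}) (nabla : {additive M -> M}).
Hypothesis d_leibniz : leibniz d.
Hypothesis nabla_connection : connection d nabla.

Lemma derivation1 : d 1 = 0.
Proof.
by have /eqP := d_leibniz 1 1; rewrite !mulr1 mul1r eq_sym -subr_eq0 addrK => /eqP.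
Qed.

Lemma derivation_divpow t j :
  d t = 1 -> (j.+1`!)%:R \is a @GRing.unit B -> d (divpow t j.+1) = divpow t j.
Proof.
move=> dt jU.
have dX k : d (t ^+ k.+1) = t ^+ k *+ k.+1.
  elim: k => [|k IH]; first by rewrite expr1 dt expr0.
  by rewrite exprS d_leibniz IH dt mul1r mulrnAr -exprS -mulrSr.
have jX : divpow t j.+1 *+ j.+1`! = t ^+ j.+1 by rewrite -[LHS]mulr_natr mulrVK.
apply: (mulIr jU); rewrite [LHS]mulr_natr -raddfMn jX dX /divpow factS mulnC natrM.
by rewrite mulrA mulrVK ?mulr_natr// (fact_unit_le _ _ _ jU).
Qed.

(* With [E] the shift [x i |-> x i.+1], formally commuting with [nabla], this is
   [(E - nabla) ^ j (x i)]. *)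
Fixpoint katz_term (x : nat -> M) (j i : nat) : M :=
  if j is j'.+1 then katz_term x j' i.+1 - nabla (katz_term x j' i) else x i.

(** Binomial expansion by Pascal's rule; [nabla] passes through the coefficients because they are
    integers. *)
Lemma katz_termE x j i :
  katz_term x j i =
  \sum_(k < j.+1) ((-1) ^+ k * ('C(j, k))%:R) *: iter k nabla (x (i + j - k)%N).
Proof.
have nablaZ k c m : nabla (((-1) ^+ k * c%:R) *: m) = ((-1) ^+ k * c%:R) *: nabla m.
  by rewrite -signr_odd !mulr_sign; case: ifP => _;
    rewrite ?scaleNr ?raddfN/= !scaler_nat raddfMn.
elim: j i => [|j IH] i.
  by rewrite big_ord1 /= expr0 mul1r scale1r addn0 subn0.
rewrite /= !IH raddf_sum /= [RHS]big_ord_recl [X in X - _]big_ord_recl /=.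
rewrite !expr0 !bin0 !mul1r !scale1r !subn0 addSnnS -addrA; congr (_ + _).
under [RHS]eq_bigr do rewrite /bump /= add1n binS natrD mulrDr scalerDl.
rewrite big_split /= [X in _ = X + _]big_ord_recr /= bin_small// mulr0 scale0r addr0.
rewrite -sumrN; congr (_ + _); apply: eq_bigr => k _.
by rewrite nablaZ exprS mulN1r mulNr scaleNr addnS subSS.
Qed.

(** A truncation of [exp(t(E - nabla))] applied to [x i]; with [n - i] terms, every index [i + j]
    that occurs stays below [n]. *)
Definition katz_partial n (x : nat -> M) (t : B) (i : nat) : M :=
  \sum_(j < n - i) divpow t j *: katz_term x j i.

(** Formally [nabla exp(t(E - nabla)) = exp(t(E - nabla)) E]: differentiating the divided power in
    term [j.+1] gives a Katz term that combines with [nabla] of term [j] into [katz_term x j i.+1].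
    The truncation leaves the last [nabla] unmatched. *)
Lemma nabla_katz_partial n x t i :
  d t = 1 -> ((n.-1)`!)%:R \is a @GRing.unit B -> (i < n)%N ->
  nabla (katz_partial n x t i) = katz_partial n x t i.+1 +
    divpow t (n - i.+1) *: nabla (katz_term x (n - i.+1) i).
Proof.
move=> dt nU ltin; rewrite /katz_partial -[(n - i)%N]prednK ?subn_gt0// -subnS.
have mn : (n - i.+1 <= n.-1)%N by rewrite subnS -!subn1 leq_sub2r// leq_subr.
move: (n - i.+1)%N mn => m mn.
rewrite raddf_sum; under eq_bigr do rewrite /= nabla_connection.
rewrite big_split /= big_ord_recl /= divpow0 derivation1 scale0r add0r.
rewrite big_ord_recr /= addrA; congr (_ + _); rewrite -big_split.
apply: eq_bigr => j _ /=; rewrite /bump /= add1n derivation_divpow//.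
  by rewrite -scalerDr /= subrK.
by apply: fact_unit_le nU; apply: leq_trans mn.
Qed.

(** The value 0 beyond [n - 1] makes the shift total, so that the estimates on Katz terms hold for
    all [i] and [j]. *)
Definition ext_basis {n} (e : 'I_n -> M) (i : nat) : M := oapp e 0 (insub i).

Lemma ext_basis_ord n (e : 'I_n -> M) (i : 'I_n) : ext_basis e i = e i.
Proof. by rewrite /ext_basis valK. Qed.

Lemma katz_partial0 n (e : 'I_n -> M) t :
  katz_partial n (ext_basis e) t 0 = katz_vector nabla e t.
Proof.
rewrite /katz_partial subn0; apply: eq_bigr => j _; congr (_ *: _).
rewrite katz_termE; apply: eq_bigr => k _; congr (_ *: iter k _ _).
by rewrite add0n -ext_basis_ord.
Qed.

(** Reindexing by [j = l - i] exhibits row [i] of the unipotent matrix as the part of [katz_partial]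
    free of [nabla]. *)
Lemma sum_divpow_mx n (e : 'I_n -> M) t (i : 'I_n) :
  \sum_(l < n) divpow_mx n t i l *: e l =
  \sum_(j < n - i) divpow t j *: ext_basis e (i + j).
Proof.
pose F l := if (i <= l)%N then divpow t (l - i) *: ext_basis e l else 0.
transitivity (\sum_(l < n) F l).
  apply: eq_bigr => l _; rewrite /F mxE ext_basis_ord.
  by case: ifP => // _; rewrite scale0r.
rewrite -(big_mkord xpredT F) (big_cat_nat (leq0n i))/=; last exact: ltnW.
rewrite [X in X + _]big_nat [X in X + _]big1 ?add0r => [|k /andP[_ ki]]; last first.
  by rewrite /F leqNgt ki.
rewrite -{1}[val i]add0n big_addn big_mkord; apply: eq_bigr => j _.
by rewrite /F leq_addl addnK addnC.
Qed.

End KatzVector.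

(** * Estimates for the derivatives of the Katz vector *)

Section KatzBound.
Context {R : realType} {B : ultrametricBanachType R} {M : lmodType B}.
Context {d : {additive B -> B}} {nabla : {additive M -> M}}.
Hypothesis d_leibniz : leibniz d.
Hypothesis nabla_connection : connection d nabla.
(** To be used with [rho = 1/|t|], [D = |d||t|] and [kappa = |G1|/|d|], so that [D * rho] is [|d|]
    and [kappa * D * rho] is [|G1|]. *)
Context {n : nat} {e : 'I_n -> M} {rho D kappa : R}.
Hypothesis rho_gt0 : 0 < rho.
Hypothesis D_ge1 : 1 <= D.
Hypothesis kappa01 : 0 <= kappa <= 1.
Hypothesis d_bound : forall b, unorm (d b) <= D * rho * unorm b.
Hypothesis nabla_bound :
  forall l : 'I_n, wbound e rho (kappa * D * rho ^+ l.+1) (nabla (e l)).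

Let x := ext_basis e.
Let rhoX k : 0 <= rho ^+ k.
Proof. exact/exprn_ge0/ltW. Qed.
Let DX k : 0 <= D ^+ k.
Proof. by rewrite exprn_ge0// (le_trans _ D_ge1). Qed.
Let kappa0 : 0 <= kappa.
Proof. by case/andP: kappa01. Qed.

Let leDX a p q k : 0 <= a -> (p <= q)%N -> a * D ^+ p * rho ^+ k <= a * D ^+ q * rho ^+ k.
Proof. by move=> a0 pq; rewrite ler_wpM2r// ler_wpM2l// ler_weXn2l. Qed.

Lemma wbound_basis (l : 'I_n) : wbound e rho (rho ^+ l) (e l).
Proof.
exists (fun k => (k == l)%:R) => [|k].
  rewrite (bigD1 l)//= eqxx scale1r big1 ?addr0// => k /negPf ->.
  by rewrite scale0r.
by case: eqP => [->|_]; rewrite ?unorm1 ?mul1r// unorm0 mul0r.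
Qed.

(** By the Leibniz rule, each [nabla] costs at most [D * rho]: through [d] on the coefficients, and
    through [kappa <= 1] on the basis vectors. *)
Lemma wbound_nabla C m :
  0 <= C -> wbound e rho C m -> wbound e rho (D * rho * C) (nabla m).
Proof.
move=> C0 [c -> cC]; rewrite raddf_sum.
have Dr0 : 0 <= D * rho by rewrite (mulr_ge0 (DX 1) (rhoX 1)).
apply: wbound_sum => // [|l _]; first by rewrite mulr_ge0.
rewrite /= nabla_connection; apply: wboundD => //.
  apply: wbound_le (wboundZ _ _ rho_gt0 _ _ _ _ (d_bound _) (wbound_basis l)).
  by rewrite -[leLHS]mulrA ler_wpM2l.
apply: wbound_le (wboundZ _ _ rho_gt0 _ _ _ _ (lexx _) (nabla_bound l)).
rewrite exprS [leLHS](_ : _ = kappa * (D * rho * (unorm (c l) * rho ^+ l))); last by ring.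
apply: (@le_trans _ _ (D * rho * (unorm (c l) * rho ^+ l))).
  by case/andP: kappa01 => _ k1; rewrite ler_piMl// mulr_ge0// mulr_ge0 ?unorm_ge0.
by rewrite ler_wpM2l.
Qed.

Lemma wbound_nabla_ext i : wbound e rho (kappa * D * rho ^+ i.+1) (nabla (x i)).
Proof.
rewrite /x /ext_basis; case: insubP => [l _ <-|_] /=; first exact: nabla_bound.
by rewrite raddf0; apply: wbound0; rewrite !mulr_ge0// (le_trans _ D_ge1).
Qed.

(** Every term of the difference contains a [nabla]. The one acting on a basis vector yields
    [kappa]; each further one costs [D * rho], each shift costs [rho], and [D >= 1] makes the
    exponent of [D] uniform. *)
Lemma wbound_katz_term j i :
  wbound e rho (kappa * D ^+ j * rho ^+ (i + j))
    (katz_term nabla x j i - x (i + j)).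
Proof.
elim: j i => [|j IH] i /=.
  by rewrite addn0 subrr; apply: wbound0; rewrite !mulr_ge0.
rewrite [X in wbound _ _ _ X](_ : _ = (katz_term nabla x j i.+1 - x (i.+1 + j)) -
  (nabla (katz_term nabla x j i - x (i + j)) + nabla (x (i + j)))); last first.
  by rewrite raddfB subrK addSnnS addrAC.
apply: wboundB => //; last apply: wboundD => //.
- by apply: wbound_le (IH i.+1); rewrite addSnnS leDX.
- apply: wbound_le (wbound_nabla _ _ _ (IH i)); last by rewrite !mulr_ge0.
  by rewrite addnS !exprS le_eqVlt; apply/orP; left; apply/eqP; ring.
- apply: wbound_le (wbound_nabla_ext _).
  by rewrite -[X in kappa * X]expr1 -addnS leDX.
Qed.

Lemma wbound_nabla_katz_term j i :
  wbound e rho (kappa * D ^+ j.+1 * rho ^+ (i + j).+1)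
    (nabla (katz_term nabla x j i)).
Proof.
rewrite -[katz_term nabla x j i](subrK (x (i + j))) raddfD; apply: wboundD => //.
  apply: wbound_le (wbound_nabla _ _ _ (wbound_katz_term j i)).
    by rewrite !exprS le_eqVlt; apply/orP; left; apply/eqP; ring.
  by rewrite !mulr_ge0.
apply: wbound_le (wbound_nabla_ext _).
by rewrite -[X in kappa * X]expr1 leDX.
Qed.

Context {t : B} {phi : R}.
Hypothesis dt : d t = 1.
Hypothesis fact_unit : ((n.-1)`!)%:R \is a @GRing.unit B.
Hypothesis phi_ge0 : 0 <= phi.
Hypothesis divpow_bound :
  forall j, (j < n)%N -> unorm (divpow t j) * rho ^+ j <= phi.

(** The divided power removes [j] factors [rho] at the price [phi], later [1/|(n-1)!|]. *)
Lemma wbound_divpowZ j C k m : (j < n)%N ->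
  wbound e rho (C * rho ^+ (k + j)) m ->
  wbound e rho (phi * C * rho ^+ k) (divpow t j *: m).
Proof.
move=> jn mC; have pos : 0 < rho ^+ j by rewrite exprn_gt0.
have b : unorm (divpow t j) <= phi / rho ^+ j by rewrite ler_pdivlMr ?divpow_bound.
apply: wbound_le (wboundZ _ _ rho_gt0 _ _ _ _ b mC).
rewrite exprD le_eqVlt [X in X == _](_ : _ = phi * C * rho ^+ k * (rho ^+ j / rho ^+ j)).
  by rewrite mulfV ?lt0r_neq0// mulr1 eqxx.
by ring.
Qed.

(** Passing from [i] to [i.+1], the old error is multiplied by [D * rho] and the unmatched last term
    of [nabla_katz_partial] is added; it already carries a factor [kappa]. *)
Lemma wbound_iter_katz i : (i < n)%N ->
  wbound e rho (phi * (kappa * D ^+ (n.-1 + i)) * rho ^+ i)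
    (iter i nabla (katz_vector nabla e t) - katz_partial nabla n x t i).
Proof.
elim: i => [|i IH] ltin.
  by rewrite /= katz_partial0 subrr; apply: wbound0; rewrite !mulr_ge0.
rewrite -[katz_partial nabla n x t i.+1](addrK (divpow t (n - i.+1) *: nabla (katz_term nabla x (n - i.+1) i))).
rewrite -(nabla_katz_partial _ _ d_leibniz nabla_connection)//; last exact: ltnW.
rewrite /= opprB addrCA addrC -raddfB; apply: wboundD => //.
  apply: wbound_le (wbound_nabla _ _ _ (IH (ltnW ltin))); last by rewrite !mulr_ge0.
  by rewrite addnS !exprS le_eqVlt; apply/orP; left; apply/eqP; ring.
have mn : (n - i.+1 < n)%N by rewrite ltn_subrL (leq_trans _ ltin).
apply: wbound_le (wbound_divpowZ _ _ i.+1 _ mn _); last first.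
  by rewrite addSn; exact: wbound_nabla_katz_term.
rewrite !mulrA leDX ?mulr_ge0//.
by rewrite addnS ltnS -subn1 (leq_trans _ (leq_addr _ _))// leq_sub2l.
Qed.

(** The error has two sources: iterating [nabla] past the truncation, and replacing each Katz term
    by its leading vector. As [i <= n.-1], both fit under the exponent [n.-1 + n.-1]. *)
Lemma wbound_iter_katz_divpow_mx (i : 'I_n) :
  wbound e rho (phi * (kappa * D ^+ (n.-1 + n.-1)) * rho ^+ i)
    (iter i nabla (katz_vector nabla e t) - \sum_(l < n) divpow_mx n t i l *: e l).
Proof.
have ltin := ltn_ord i; have n0 : (0 < n)%N by rewrite (leq_trans _ ltin).
have lt_predn k : (k < n)%N -> (k <= n.-1)%N by move=> kn; rewrite -ltnS prednK.
rewrite -[iter _ _ _](subrK (katz_partial nabla n x t i)) -addrA.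
apply: wboundD => //.
  apply: wbound_le (wbound_iter_katz _ ltin).
  by rewrite !mulrA leDX ?mulr_ge0// leq_add2l lt_predn.
rewrite sum_divpow_mx /katz_partial -sumrB; apply: wbound_sum => //.
  by rewrite !mulr_ge0.
move=> j _; rewrite -scalerBr.
have jn : (j < n)%N by apply: leq_trans (ltn_ord j) (leq_subr _ _).
apply: wbound_le (wbound_divpowZ _ _ i _ jn (wbound_katz_term j i)).
by rewrite !mulrA leDX ?mulr_ge0// (leq_trans (lt_predn _ jn)) ?leq_addr.
Qed.

End KatzBound.

(** * Norms of derivations, matrices and divided powers *)

Section NormEstimates.
Context {R : realType} {B : ultrametricBanachType R}.

Lemma unorm_le_opnorm (d : {additive B -> B}) (b : B) :
  finite_opnorm d -> unorm (d b) <= opnorm d * unorm b.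
Proof.
move=> d_finite; have [->|b0] := eqVneq b 0.
  by rewrite raddf0 !unorm0 mulr0.
rewrite -ler_pdivrMr ?unorm_gt0//; apply: ub_le_sup => //.
by exists b.
Qed.

Lemma rho_norm_ge n (rho : R) (A : 'M[B]_n) (i j : 'I_n) :
  0 < rho -> unorm (A i j) * rho ^+ j <= rho_norm rho A * rho ^+ i.
Proof.
move=> rho0; rewrite -ler_pdivrMr ?exprn_gt0// -mulrA.
have -> : rho ^+ j / rho ^+ i = rho ^ (j%:Z - i%:Z).
  by rewrite expfzDr ?lt0r_neq0// -exprnN.
apply: le_trans (le_bigmax _ _ i).
exact: (le_bigmax _ (fun j => unorm (A i j) * rho ^ (j%:Z - i%:Z))).
Qed.

(** The powers of [s] cancel against those of [rho]. The norm is multiplicative on integers, so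
    [1/j!] has norm [1/|j!|], and [|m!| <= |j!|] because the cofactor is an integer, of norm at most
    1. *)
Lemma unorm_divpow_le (s : B) (m j : nat) (rho : R) :
  0 < rho -> unorm s * rho = 1 -> (m`!)%:R \is a @GRing.unit B -> (j <= m)%N ->
  unorm (divpow s j) * rho ^+ j <= (unorm (m`!%:R : B))^-1.
Proof.
move=> rho0 srho mU jm; have jU := fact_unit_le _ _ jm mU.
have unorm_unit_gt0 (u : B) : u \is a GRing.unit -> 0 < unorm u.
  by move=> uU; apply: unorm_gt0; apply: contraTneq uU => ->; rewrite unitr0.
apply: (@le_trans _ _ (unorm (j`!%:R^-1 : B))).
  have one : (unorm s * rho) ^+ j = 1 by rewrite srho expr1n.
  rewrite -[leRHS]mul1r -one exprMn mulrAC.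
  by rewrite ler_wpM2r ?exprn_ge0 ?(ltW rho0)// /divpow unormM_le ?unormX_le.
have -> : unorm (j`!%:R^-1 : B) = (unorm (j`!%:R : B))^-1.
  apply: (mulfI (lt0r_neq0 (unorm_unit_gt0 _ jU))).
  by rewrite -unorm_natM divrr// unorm1 divff// lt0r_neq0 ?unorm_unit_gt0.
rewrite lef_pV2 ?posrE ?unorm_unit_gt0// (fact_split jm) natrM unorm_natM.
by rewrite ler_piMr ?unorm_ge0 ?unorm_nat_le1.
Qed.

End NormEstimates.

(** * Choice of the constants and cyclicity of the Katz vector *)

Theorem proposition2p5 (R : realType) (B : ultrametricBanachType R)
    (d : {additive B -> B}) (d_leibniz : leibniz d)
    (d_continuous : unorm_continuous d) (d_finite : finite_opnorm d)
    (M : lmodType B) (nabla : {additive M -> M})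
    (nabla_connection : connection d nabla)
    (n : nat) (n_gt0 : (0 < n)%N)
    (e : 'I_n -> M) (e_basis : is_basis e)
    (fact_unit : ((n.-1)`!)%:R \is a @GRing.unit B)
    (t : B) (dt : d t = 1)
    (G1 : 'M[B]_n) (G1E : matrix_in_basis nabla e G1)
    (G1_small :
      rho_norm (unorm t)^-1 G1 <
        unorm (((n.-1)`!)%:R : B) ^+ 2 * opnorm d /
          (opnorm d * unorm t) ^+ (2 * n - 2)) :
  cyclic n nabla /\ cyclic_vector n nabla (katz_vector nabla e t).
Proof.
suff katz_cyclic : cyclic_vector n nabla (katz_vector nabla e t).
  by split=> //; exists (katz_vector nabla e t).
have d_le b := unorm_le_opnorm _ b d_finite.
(* From [1 = |d t| <= |d||t|] come [D >= 1], [t != 0] and [|d| > 0]. *)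
have d1 : 1 <= opnorm d * unorm t by rewrite -(unorm1 (s := B)) -dt d_le.
have t_neq0 : t != 0.
  by apply/eqP => t0; move: d1; rewrite t0 unorm0 mulr0 ler10.
have tau_gt0 := unorm_gt0 _ t_neq0.
have delta_gt0 : 0 < opnorm d by rewrite -(pmulr_lgt0 _ tau_gt0) (lt_le_trans _ d1).
set f := unorm (n.-1)`!%:R in G1_small.
have f_gt0 : 0 < f.
  by apply: unorm_gt0; apply: contraTneq fact_unit => ->; rewrite unitr0.
have f_le1 : f <= 1 by exact: unorm_nat_le1.
pose g := rho_norm (unorm t)^-1 G1; pose rho := (unorm t)^-1.
pose D := opnorm d * unorm t; pose kappa := g / opnorm d.
have rho_gt0 : 0 < rho by rewrite invr_gt0.
have fV_ge0 : 0 <= f^-1 by rewrite invr_ge0 ltW.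
have D_rho : D * rho = opnorm d by rewrite mulfK// gt_eqF.
have t_rho : unorm t * rho = 1 by rewrite mulfV// gt_eqF.
have le_predn k : (k < n)%N -> (k <= n.-1)%N by move=> kn; rewrite -ltnS prednK.
have g_ge0 : 0 <= g by rewrite /g /rho_norm bigmax_ge_id.
have kappa_ge0 : 0 <= kappa by rewrite divr_ge0// ltW.
have DX_ge1 k : 1 <= D ^+ k by rewrite exprn_ege1.
(* The smallness assumption on [G1], divided by [|d|] and by the square of [f]. *)
have kappa_small : f^-1 * (f^-1 * (kappa * D ^+ (n.-1 + n.-1))) < 1.
  have -> : (n.-1 + n.-1 = 2 * n - 2)%N by rewrite -subn1 addnn -mul2n mulnBr.
  rewrite mulrA -invfM mulrC ltr_pdivrMr ?mulr_gt0// mul1r -expr2.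
  rewrite /kappa mulrAC ltr_pdivrMr// -ltr_pdivlMr//.
  by rewrite (lt_le_trans ltr01).
(* Here [f ^+ 2 <= 1 <= D ^+ (2 * n - 2)], so the assumption also gives [g <= |d|]. *)
have kappa_le1 : kappa <= 1.
  rewrite -ler_pdivlMr ?invr_gt0// invrK mul1r; apply: (le_trans (ltW G1_small)).
  rewrite ler_pdivrMr ?(lt_le_trans ltr01)// mulrC ler_wpM2l ?(ltW delta_gt0)//.
  by rewrite (le_trans _ (DX_ge1 _))// expr_le1// ltW.
(* One factor [f^-1] bounds the inverse unipotent matrix, the other the divided powers in the Katz
   vector. *)
apply: (is_basis_near_divpow _ _ rho_gt0 f^-1 (f^-1 * (kappa * D ^+ (n.-1 + n.-1))) t
  _ e_basis fact_unit).
- by move=> k kn; apply: unorm_divpow_le; rewrite ?unormN ?le_predn.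
- rewrite kappa_small andbT mulr_ge0// mulr_ge0// mulr_ge0//.
  exact: le_trans ler01 (DX_ge1 _).
move=> i; apply: (wbound_iter_katz_divpow_mx (d := d)) => //.
- by rewrite kappa_ge0.
- by move=> b; rewrite D_rho.
- move=> l; exists (G1 l) => // j.
  rewrite exprS -mulrA [D * _]mulrA D_rho mulrA /kappa divfK ?gt_eqF//.
  exact: rho_norm_ge.
- by move=> j jn; apply: unorm_divpow_le; rewrite ?le_predn.
Qed.
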